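(* The ordering on $\mathbb{E}=S/B$ is complete; that is, every subset of $\mathbb{E}$ that is non-empty and bounded above has a supremum in $\mathbb{E}$.
   Context: A function $f:\mathbb{Z}\to\mathbb{Z}$ is an almost homomorphism iff the function $d_f(p,q)=f(p+q)-f(p)-f(q)$ from $\mathbb{Z}\times\mathbb{Z}$ to $\mathbb{Z}$ has bounded range, i.e. for some integer $C$, $|d_f(p,q)|<C$ for all $p,q\in\mathbb{Z}$. $S$ is the abelian group of all almost homomorphisms $\mathbb{Z}\to\mathbb{Z}$ under pointwise addition, and $B$ is the subgroup of all functions $\mathbb{Z}\to\mathbb{Z}$ with bounded range. The abelian group of Eudoxus reals is the quotient $\mathbb{E}=S/B$; $[f]$ denotes the class of $f\in S$. $\mathbb{E}$ is totally ordered by $x<y$ iff $y-x\in P$, where $P$ is the set of all $[f]\in\mathbb{E}$ such that $f(m)$ takes on infinitely many positive values as $m$ ranges over $\mathbb{N}$ (the non-negative integers); this does not depend on the choice of representative. A supremum of a subset $T$ of a totally ordered set $A$ is an element $s\in A$ (not necessarily in $T$) such that (1) $x\le s$ for every $x\in T$, and (2) for any $y\in A$, if $x\le y$ whenever $x\in T$, then $s\le y$. *)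

(* Defs.v *)
From HB Require Import structures.
From mathcomp Require Import all_boot all_order all_algebra.
From mathcomp Require Import zify.
From mathcomp Require Import boolp classical_sets functions cardinality.

Set Implicit Arguments.
Unset Strict Implicit.
Unset Printing Implicit Defensive.

Import Order.TTheory GRing.Theory Num.Theory.

Local Open Scope classical_set_scope.
Local Open Scope ring_scope.

Definition bounded_range (T : Type) (f : T -> int) : Prop :=
  exists C : int, forall x, `|f x| < C.

Definition hom_defect (f : int -> int) (pq : int * int) : int :=
  f (pq.1 + pq.2) - f pq.1 - f pq.2.

Definition almost_hom : {pred int -> int} :=
  fun f => `[< bounded_range (hom_defect f) >].

Lemma almost_homP (f : int -> int) :
  reflect (exists C : int, forall p q : int, `|f (p + q) - f p - f q| < C)
    (almost_hom f).
Proof.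
apply: (iffP (asboolP _)) => -[C hC]; exists C.
  by move=> p q; exact: (hC (p, q)).
by move=> [p q]; exact: hC.
Qed.

Fact almost_hom_zmod_closed : zmod_closed almost_hom.
Proof.
split=> [|f g /almost_homP[C hC] /almost_homP[D hD]]; apply/almost_homP.
  by exists 1.
exists (C + D) => p q; have := hC p q; have := hD p q; rewrite !fctE; lia.
Qed.

HB.instance Definition _ :=
  GRing.isZmodClosed.Build (int -> int) almost_hom almost_hom_zmod_closed.

Record almostHom := AlmostHom {
  ah_fun :> int -> int;
  ah_funP : ah_fun \in almost_hom }.

HB.instance Definition _ := [isSub for ah_fun].
HB.instance Definition _ := [Choice of almostHom by <:].
HB.instance Definition _ := [SubChoice_isSubZmodule of almostHom by <:].

Lemma ah0E x : (0 : almostHom) x = 0. Proof. by []. Qed.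
Lemma ahNE (f : almostHom) x : (- f) x = - f x. Proof. by []. Qed.
Lemma ahDE (f g : almostHom) x : (f + g) x = f x + g x. Proof. by []. Qed.
Lemma ahBE (f g : almostHom) x : (f - g) x = f x - g x. Proof. by []. Qed.

Lemma bounded_almost_hom (f : int -> int) : bounded_range f -> f \in almost_hom.
Proof.
move=> [C hC]; apply/almost_homP; exists (C + C + C) => p q.
have := hC (p + q); have := hC p; have := hC q; lia.
Qed.

(* The subgroup of bounded functions, seen inside almostHom; no bounded function
   is lost, by bounded_almost_hom. *)
Definition bounded_ah : {pred almostHom} := fun f => `[< bounded_range f >].

Fact bounded_ah_zmod_closed : zmod_closed bounded_ah.
Proof.
split=> [|f g /asboolP[C hC] /asboolP[D hD]]; apply/asboolP.
  by exists 1.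
exists (C + D) => p; have := hC p; have := hD p.
rewrite ahBE; lia.
Qed.

HB.instance Definition _ :=
  GRing.isZmodClosed.Build almostHom bounded_ah bounded_ah_zmod_closed.

Definition eudoxus : Type := Quotient.quot bounded_ah.

HB.instance Definition _ := GRing.Zmodule.on eudoxus.

Definition eclass (f : almostHom) : eudoxus :=
  (\pi_(Quotient.quot bounded_ah) f)%qT.

Definition infinite_pos_values (f : int -> int) : Prop :=
  infinite_set [set y : int | 0 < y /\ exists m : nat, f m%:Z = y].

Definition eudoxus_pos : set eudoxus :=
  [set x | exists2 f : almostHom, x = eclass f & infinite_pos_values f].

Definition eudoxus_lt : rel eudoxus := fun x y => `[< eudoxus_pos (y - x) >].

Lemma infinite_pos_values_unbounded (f : int -> int) :
  infinite_pos_values f <-> forall D : int, exists m : nat, D < f m%:Z.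
Proof.
split=> [finf D|funb].
  apply: contrapT => /forallNP hD; apply: finf.
  apply: (@sub_finite_set _ _ ((fun n : nat => n%:Z) @` `I_(`|D|%N.+1))).
    move=> y [y0 [m fmy]]; have /negP := hD m; rewrite -leNgt fmy => yD.
    by exists `|y|%N => /=; lia.
  exact/finite_image/finite_II.
move=> /finite_seqP[s sE].
have [D hD] : exists D : int, forall y, y \in s -> y <= D.
  elim: s {sE} => [|a s [D IH]]; first by exists 0.
  exists (Num.max a D) => y; rewrite inE => /orP[/eqP->|/IH yD].
    by rewrite le_max lexx.
  by rewrite le_max yD orbT.
have [m hm] := funb (Num.max 0 D).
have : [set` s] (f m%:Z) by rewrite -sE; split; [lia|exists m].
by move=> /= /hD; lia.
Qed.

Lemma bounded_infinite_pos_values (f g : int -> int) :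
  bounded_range (f - g) -> infinite_pos_values f -> infinite_pos_values g.
Proof.
move=> [C hC] /infinite_pos_values_unbounded hf.
apply/infinite_pos_values_unbounded => D; have [m hm] := hf (D + C).
by exists m; have := hC m%:Z; rewrite !fctE; lia.
Qed.

Lemma eclass_eqP (f g : almostHom) :
  eclass f = eclass g <-> bounded_range (f - g).
Proof.
split=> [/eqP|fg].
  by rewrite -Quotient.idealrBE => /asboolP.
by apply/eqP; rewrite -Quotient.idealrBE; apply/asboolP.
Qed.

Lemma eudoxus_posE (f : almostHom) :
  eudoxus_pos (eclass f) <-> infinite_pos_values f.
Proof.
split=> [[g /esym/eclass_eqP gf]|hf]; last by exists f.
exact: bounded_infinite_pos_values.
Qed.

Lemma almost_hom_limit (f : almostHom) : infinite_pos_values f ->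
  forall D : int, exists N : nat, forall p : nat, (N <= p)%N -> D < f p%:Z.
Proof.
move=> /infinite_pos_values_unbounded hf D.
have [C hC] := almost_homP _ (ah_funP f).
have [M hM] := hf C.
have f0 : `|f 0| < C by have := hC 0 0; rewrite addr0; lia.
have M0 : (0 < M)%N.
  rewrite lt0n; apply: contraTneq hM => ->.
  by rewrite -leNgt; apply: le_trans (ler_norm _) (ltW f0).
have [K hK] : exists K : int, forall r : nat, (r < M)%N -> `|f r%:Z| <= K.
  elim: (M) => [|m [K hK]]; first by exists 0.
  exists (Num.max K `|f m%:Z|) => r; rewrite ltnS leq_eqVlt.
  by move=> /orP[/eqP->|/hK]; lia.
have kM (k : nat) : k%:Z - C <= f (k * M)%N%:Z.
  elim: k => [|k IH]; first by rewrite mul0n; move: f0; rewrite -[0]/(0%:Z); lia.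
  have := hC (k * M)%N%:Z M%:Z; rewrite -PoszD addnC -mulSn; lia.
exists (`|(D + K + C + C)%R|.+1 * M)%N => p hp.
have -> : p = (p %/ M * M + p %% M)%N by exact: divn_eq.
have := hK _ (ltn_pmod p M0).
have := kM (p %/ M)%N.
have := hC (p %/ M * M)%N%:Z (p %% M)%N%:Z; rewrite -PoszD.
have : (`|(D + K + C + C)%R|.+1 <= p %/ M)%N by rewrite leq_divRL.
move: (p %/ M)%N (f _) (f _) => q a b; lia.
Qed.

Lemma eudoxus_posD (x y : eudoxus) :
  eudoxus_pos x -> eudoxus_pos y -> eudoxus_pos (x + y).
Proof.
move=> [f -> hf] [g -> hg]; exists (f + g).
  by rewrite /eclass raddfD.
apply/infinite_pos_values_unbounded => D.
have [N hN] := almost_hom_limit hf `|D|.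
have [N' hN'] := almost_hom_limit hg 0.
exists (N + N')%N; have := hN _ (leq_addr N' N); have := hN' _ (leq_addl N N').
by rewrite ahDE; lia.
Qed.

Lemma eudoxus_pos0 : ~ eudoxus_pos 0.
Proof.
have -> : 0 = eclass 0 :> eudoxus by rewrite /eclass raddf0.
move=> /eudoxus_posE /infinite_pos_values_unbounded /(_ 0)[m].
by rewrite ltxx.
Qed.

Lemma eudoxus_pos_total (x : eudoxus) :
  x != 0 -> eudoxus_pos x \/ eudoxus_pos (- x).
Proof.
have [f ->] : exists f, x = eclass f.
  by exists (repr (x : Quotient.quot bounded_ah)); rewrite /eclass reprK.
move=> fN0; apply: contrapT => /not_orP[].
have -> : - eclass f = eclass (- f) by rewrite /eclass raddfN.
rewrite !eudoxus_posE !infinite_pos_values_unbounded.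
move=> /existsNP[K /forallNP hK] /existsNP[L /forallNP hL].
move/eqP: fN0; apply.
have -> : 0 = eclass 0 :> eudoxus by rewrite /eclass raddf0.
apply/eclass_eqP; have [C hC] := almost_homP _ (ah_funP f).
exists (`|K| + `|L| + C + `|f 0| + 1) => p.
rewrite ahBE ah0E subr0.
have := hK `|p|%N; have := hL `|p|%N; rewrite !ahNE.
have := hC p (- p); rewrite subrr.
case: p => p; rewrite ?NegzE ?opprK ?abszN ?absz_nat => + /negP + /negP;
  rewrite -!leNgt; move: (f _) (f _) (f _) => a b c; lia.
Qed.

Fact eudoxus_lt_irr : irreflexive eudoxus_lt.
Proof.
by move=> x; apply/negbTE/asboolPn; rewrite subrr; exact: eudoxus_pos0.
Qed.

Fact eudoxus_lt_trans : transitive eudoxus_lt.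
Proof.
move=> y x z /asboolP xy /asboolP yz; apply/asboolP.
have -> : z - x = (z - y) + (y - x) by rewrite addrA subrK.
exact: eudoxus_posD.
Qed.

HB.instance Definition _ := Order.Lt_isPOrder.Build ring_display eudoxus
  eudoxus_lt_irr eudoxus_lt_trans.

Fact eudoxus_le_total : total (<=%R : rel eudoxus).
Proof.
move=> x y; rewrite !le_eqVlt (eq_sym y x).
have [//|xy] := eqVneq x y; rewrite /=; apply/orP.
have : y - x != 0 by rewrite subr_eq0 eq_sym.
by move=> /eudoxus_pos_total[] h; [left|right]; apply/asboolP; rewrite // -opprB.
Qed.

HB.instance Definition _ :=
  Order.POrder_isTotal.Build ring_display eudoxus eudoxus_le_total.

Lemma eudoxus_ltE (x y : eudoxus) : (x < y) = `[< eudoxus_pos (y - x) >].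
Proof. by []. Qed.

(* Main.v *)
Require Import Defs.
From mathcomp Require Import all_boot all_order all_algebra.
From mathcomp Require Import zify.
From mathcomp Require Import boolp classical_sets.

(** The supremum [s] of [T] is built from the integer parts of its multiples.
    Write [1] for the class of the identity. For each natural number [n] the
    set of integers [c] with [c * 1 <= n * x] for some [x] in [T] is non-empty
    and bounded above; let [a n] be its greatest element, which plays the role
    of the integer part of [n * s] ([scaled_sup_floor]).

    Since [T] is totally ordered, any two of its elements lie below a third
    one, and this gives [a m + a n <= a (m + n) <= a m + a n + 1]. So [a],
    extended to an odd function on all integers, is an almost homomorphism [f]
    ([almost_hom_of_nat]).

    The class of [f] is the supremum because of two facts about almost
    homomorphisms. First, [f n] determines [n * eclass f] up to an integer
    error that does not depend on [n] ([eclassMn_near]). Secondly, the ordered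
    group is Archimedean: if [n * x <= n * y + c * 1] for a fixed [c] and all
    [n], then [x <= y] ([eudoxus_archimedean]). Thus inequalities between Eudoxus
    reals follow from inequalities between the integers [a n], in which any
    bounded error is harmless. *)

Import Order.TTheory GRing.Theory Num.Theory.

Local Open Scope classical_set_scope.
Local Open Scope ring_scope.

Lemma eclass_surj (x : eudoxus) : exists f : almostHom, x = eclass f.
Proof.
by exists (repr (x : Quotient.quot bounded_ah)); rewrite /eclass reprK.
Qed.

Lemma ahMnE (f : almostHom) (n : nat) (p : int) : (f *+ n) p = f p *+ n.
Proof. by elim: n => // n IHn; rewrite !mulrS ahDE IHn. Qed.

Lemma ahMzE (f : almostHom) (c p : int) : (f *~ c) p = f p *~ c.
Proof.
by case: c => n; rewrite ?NegzE ?mulrNz ?ahNE -!pmulrn ahMnE.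
Qed.

(** A non-strict inequality is a pointwise inequality up to a constant, because
    the difference [f - g] fails to be positive exactly when it is bounded above
    on the natural numbers. *)
Lemma eclass_leP (f g : almostHom) :
  eclass f <= eclass g <->
  exists D : int, forall k : nat, f k%:Z <= g k%:Z + D.
Proof.
have -> : eclass f <= eclass g <-> ~ infinite_pos_values (f - g).
  rewrite -eudoxus_posE /eclass raddfB leNgt eudoxus_ltE.
  by split=> [/negP + h|h]; [apply; apply/asboolP|apply/negP => /asboolP].
rewrite infinite_pos_values_unbounded; split=> [/existsNP[D hD]|[D hD]].
  exists D => k; rewrite leNgt; apply/negP => fgD.
  by apply: hD; exists k; rewrite ahBE; lia.
by move=> /(_ D)[k]; rewrite ahBE; have := hD k; lia.
Qed.

Lemma eudoxus_ltD2r (z x y : eudoxus) : (x + z < y + z) = (x < y).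
Proof. by rewrite !eudoxus_ltE opprD addrACA subrr addr0. Qed.

Lemma eudoxus_leD2r (z x y : eudoxus) : (x + z <= y + z) = (x <= y).
Proof. by rewrite !leNgt eudoxus_ltD2r. Qed.

Lemma eudoxus_leD {x y z t : eudoxus} : x <= y -> z <= t -> x + z <= y + t.
Proof.
move=> xy zt; apply: (@le_trans _ _ (y + z)); first by rewrite eudoxus_leD2r.
by rewrite ![y + _]addrC eudoxus_leD2r.
Qed.

Lemma eudoxus_ltD {x y z t : eudoxus} : x < y -> z < t -> x + z < y + t.
Proof.
move=> xy zt; apply: (@lt_trans _ _ (y + z)); first by rewrite eudoxus_ltD2r.
by rewrite ![y + _]addrC eudoxus_ltD2r.
Qed.

Lemma eudoxus_leMn (n : nat) {x y : eudoxus} : x <= y -> x *+ n <= y *+ n.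
Proof. by move=> xy; elim: n => // n IHn; rewrite !mulrS eudoxus_leD. Qed.

Lemma id_almost_hom : (id : int -> int) \in almost_hom.
Proof. by apply/almost_homP; exists 1 => p q; lia. Qed.

(** The order unit with which all Eudoxus reals are compared: [eudoxus_one *~ c]
    is the integer [c] seen as a Eudoxus real. *)
Definition eudoxus_one : eudoxus := eclass (AlmostHom id_almost_hom).

Lemma eudoxus_one_MzE (c : int) :
  eudoxus_one *~ c = eclass (AlmostHom id_almost_hom *~ c).
Proof. by rewrite /eudoxus_one /eclass raddfMz. Qed.

Lemma eudoxus_one_le (c d : int) :
  (eudoxus_one *~ c <= eudoxus_one *~ d) = (c <= d).
Proof.
rewrite !eudoxus_one_MzE; apply/idP/idP => [/eclass_leP[D hD]|cd].
  by have := hD `|D|.+1; rewrite !ahMzE /= !mulrzz; nia.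
by apply/eclass_leP; exists 0 => k; rewrite !ahMzE /= !mulrzz; nia.
Qed.

Lemma eudoxus_one_lt (c d : int) :
  (eudoxus_one *~ c < eudoxus_one *~ d) = (c < d).
Proof. by rewrite !ltNge eudoxus_one_le. Qed.

(** An almost homomorphism commutes with multiplication by [n] up to one defect
    for each of the [n] additions, plus one for the value at [0]. *)
Lemma almost_homMn {f : int -> int} {C : int} :
  (forall p q, `|f (p + q) - f p - f q| < C) ->
  forall (n : nat) (p : int), `|f (p *+ n) - f p *+ n| <= C * n.+1%:Z.
Proof.
move=> hC n p; elim: n => [|n IHn].
  have := hC 0 0; rewrite addr0 !mulr0n; move: (f _) => u; lia.
have := hC p (p *+ n); rewrite !mulrS; move: IHn.
move: (f _) (f _) (f p *+ n) => u v w; lia.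
Qed.

(** The function [k |-> n * f k] represents [n * eclass f], and both it and
    [k |-> k * f n] are close to [k |-> f (n * k)]: the first up to a constant
    (depending on [n]), the second up to [C * k] plus a constant. The constants
    vanish in the quotient, and [C * k] amounts to an error of [C] times the unit,
    uniformly in [n]. *)
Lemma eclassMn_near (f : almostHom) : exists C : int, forall n : nat,
  eudoxus_one *~ (f n%:Z - C) <= eclass f *+ n <= eudoxus_one *~ (f n%:Z + C).
Proof.
have [C hC] := almost_homP _ (ah_funP f); exists C => n.
(* Both sides of the difference are compared with [f (n * k)]. *)
have near (k : nat) :
    `|f n%:Z * k%:Z - f k%:Z * n%:Z| <= C * n.+1%:Z + C + C * k%:Z.
  have := almost_homMn hC n k%:Z; have := almost_homMn hC k n%:Z.
  rewrite !pmulrn !mulrzz [n%:Z * _]mulrC (intS k) mulrDr mulr1.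
  move: (f (_ * _)) (f _ * _) (f _ * _) (C * _) (C * _) => u v w x y; lia.
have {}near (k : nat) :
    (f n%:Z - C) * k%:Z <= f k%:Z * n%:Z + (C * n.+1%:Z + C) /\
    f k%:Z * n%:Z <= (f n%:Z + C) * k%:Z + (C * n.+1%:Z + C).
  have := near k; rewrite mulrBl mulrDl.
  move: (f _ * _) (f _ * _) (C * _) (C * _) => u v w x; lia.
rewrite !eudoxus_one_MzE /eclass -raddfMn /=.
by apply/andP; split; apply/eclass_leP; exists (C * n.+1%:Z + C) => k;
  rewrite ahMzE ahMnE /= pmulrn !mulrzz [k%:Z * _]mulrC;
  have [] := near k.
Qed.

(** Were [x - y] positive, a representative [f] of it would take arbitrarily
    large values [f n]; but [f n] is up to a constant a lower bound for
    [n * (x - y)], hence for [c]. *)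
Lemma eudoxus_archimedean {x y : eudoxus} (c : int) :
  (forall n : nat, x *+ n <= y *+ n + eudoxus_one *~ c) -> x <= y.
Proof.
move=> hxy; rewrite leNgt eudoxus_ltE; apply/negP => /asboolP.
have [f fE] := eclass_surj (x - y); rewrite fE eudoxus_posE.
have [C hC] := eclassMn_near f.
move=> /infinite_pos_values_unbounded /(_ (c + C))[n]; apply/negP.
rewrite -leNgt -lerBlDr -eudoxus_one_le; have /andP[+ _] := hC n.
move=> /le_trans; apply.
by rewrite -fE mulrnBl -(eudoxus_leD2r (y *+ n)) subrK addrC.
Qed.

(** The least distance from the upper bound [u] to an element of [A] is attained,
    by well-foundedness of the natural numbers. *)
Lemma int_max {A : set int} {a u : int} :
  A a -> (forall c, A c -> c <= u) -> exists2 m, A m & forall c, A c -> c <= m.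
Proof.
move=> Aa Au; pose P (k : nat) := `[< A (u - k%:Z) >].
have uE c : A c -> u - `|u - c|%N%:Z = c by move=> /Au; lia.
have exP : exists k, P k by exists `|u - a|%N; apply/asboolP; rewrite uE.
have [k /asboolP Ak kmin] := ex_minnP exP; exists (u - k%:Z) => // c Ac.
have /kmin : P `|u - c|%N by apply/asboolP; rewrite uE.
by have := Au _ Ac; lia.
Qed.

(** This produces the integer part of [n] times the supremum of [T] before the
    supremum itself is known to exist. *)
Lemma scaled_sup_floor {T : set eudoxus} :
  T !=set0 -> has_ubound T -> forall n : nat, exists a : int,
    (exists2 x, T x & eudoxus_one *~ a <= x *+ n) /\
    (forall x, T x -> x *+ n < eudoxus_one *~ (a + 1)).
Proof.
move=> [x Tx] [y Ty] n.
have [f fE] := eclass_surj x; have [C hC] := eclassMn_near f.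
have [g gE] := eclass_surj y; have [D hD] := eclassMn_near g.
pose A : set int := [set c | exists2 z, T z & eudoxus_one *~ c <= z *+ n].
have Af : A (f n%:Z - C) by exists x => //; rewrite fE; case/andP: (hC n).
have Au c : A c -> c <= g n%:Z + D.
  move=> [z Tz cz]; rewrite -eudoxus_one_le; apply: le_trans cz _.
  apply: le_trans (eudoxus_leMn n (Ty z Tz)) _.
  by rewrite gE; case/andP: (hD n).
have [a Aa amax] := int_max Af Au; exists a; split=> // z Tz.
rewrite ltNge; apply/negP => az.
by have : a + 1 <= a by [apply: amax; exists z]; lia.
Qed.

Lemma almost_hom_of_nat {a : nat -> int} {C : int} :
  (forall m n, `|a (m + n)%N - a m - a n| < C) ->
  exists f : almostHom, forall n : nat, f n%:Z = a n.
Proof.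
move=> hC; pose f (p : int) : int := if 0 <= p then a `|p|%N else - a `|p|%N.
suff fh : f \in almost_hom by exists (AlmostHom fh).
apply/almost_homP; exists C.
move=> p q; rewrite /f.
(* By oddness, the defect at (p, q) is, up to sign, the defect of [a] at two of
   the absolute values of p, q, p + q whose sum is the third one. *)
have aD i j k : (i + j = k)%N -> `|a k - a i - a j| < C by move=> <-.
case: (lerP 0 p) => p0; case: (lerP 0 q) => q0; case: (lerP 0 (p + q)) => pq0.
- by apply: aD; lia.
- by lia.
- have {aD} := aD `|(p + q)%R|%N `|q|%N `|p|%N ltac:(lia).
  by move: (a _) (a _) (a _) => u v w; lia.
- have {aD} := aD `|(p + q)%R|%N `|p|%N `|q|%N ltac:(lia).
  by move: (a _) (a _) (a _) => u v w; lia.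
- have {aD} := aD `|(p + q)%R|%N `|p|%N `|q|%N ltac:(lia).
  by move: (a _) (a _) (a _) => u v w; lia.
- have {aD} := aD `|(p + q)%R|%N `|q|%N `|p|%N ltac:(lia).
  by move: (a _) (a _) (a _) => u v w; lia.
- by lia.
- have {aD} := aD `|p|%N `|q|%N `|(p + q)%R|%N ltac:(lia).
  by move: (a _) (a _) (a _) => u v w; lia.
Qed.

Theorem theorem18 (T : set eudoxus) (T_neq0 : T !=set0) (T_ub : has_ubound T) :
  exists s : eudoxus, supremums T s.
Proof.
have [a aP] := choice (scaled_sup_floor T_neq0 T_ub).
(* A single [z] in [T] above the witnesses for [m] and [n] has
   [a m + a n <= (m + n) * z]. *)
have a_super m n : a m + a n <= a (m + n)%N.
  have [[x Tx xm] _] := aP m; have [[y Ty yn] _] := aP n.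
  have [z Tz [xz yz]] : exists2 z, T z & x <= z /\ y <= z.
    by case: (leP x y) => xy; [exists y|exists x => //; split=> //; apply: ltW].
  rewrite -ltzD1 -eudoxus_one_lt.
  have [_ /(_ _ Tz)] := aP (m + n)%N; apply: le_lt_trans.
  rewrite mulrzDr mulrnDr; apply: eudoxus_leD.
    by apply: le_trans xm _; apply: eudoxus_leMn.
  by apply: le_trans yn _; apply: eudoxus_leMn.
(* The witness for [m + n] is bounded by [a m + 1] after scaling by [m] and by
   [a n + 1] after scaling by [n]; strictness gains the last unit. *)
have a_sub m n : a (m + n)%N <= a m + a n + 1.
  have [[z Tz zmn] _] := aP (m + n)%N.
  have [_ /(_ _ Tz) zm] := aP m; have [_ /(_ _ Tz) zn] := aP n.
  have := le_lt_trans zmn; rewrite mulrnDr => /(_ _ (eudoxus_ltD zm zn)).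
  by rewrite -mulrzDr eudoxus_one_lt; lia.
have [f fE] : exists f : almostHom, forall n : nat, f n%:Z = a n.
  apply: (@almost_hom_of_nat _ 2) => m n.
  by have := a_super m n; have := a_sub m n; lia.
have [C hC] := eclassMn_near f.
exists (eclass f); split=> [x Tx|y Ty].
  apply: (eudoxus_archimedean (C + 1)) => n.
  have [_ /(_ _ Tx) /ltW /le_trans] := aP n; apply.
  (* [n * x] is below [a n + 1], and [a n - C] is below [n * eclass f]. *)
  have -> : a n + 1 = (a n - C) + (C + 1) by lia.
  rewrite mulrzDr eudoxus_leD2r -fE.
  by case/andP: (hC n).
apply: (eudoxus_archimedean C) => n.
have /andP[_ /le_trans] := hC n; apply.
rewrite mulrzDr eudoxus_leD2r fE.
have [[x Tx /le_trans xn] _] := aP n; apply: xn.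
by apply: eudoxus_leMn; apply: Ty.
Qed.
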